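(* For all positive integers $r,n$, the following identity holds in $\mathbb{Z}[[z_0,\ldots,z_n]]$: \[ \sum_{ k \ge 0 } \prod_{ j=1 }^n [rk+1]_{ z_j } \, z_0^k \ = \ \sum_{ (\pi,\epsilon)\in \mathbb{Z}_r\wr S_n } \frac{ \displaystyle z_0^{\left\lceil \operatorname{ch}(\epsilon)/r \right\rceil } \prod_{j=1}^nz_{\pi(1)}^{a_j^\epsilon}z_{\pi(2)}^{a_j^\epsilon}\cdots z_{\pi(j)}^{a_j^\epsilon} \prod_{\substack{j\in \mathrm{Des}(\pi) \\ a_j^\epsilon=0 }}z_0z_{\pi(1)}^rz_{\pi(2)}^r\cdots z_{\pi(j)}^r }{ \displaystyle \prod_{ j=0 }^n \left( 1 - z_0 \, z_{\pi(1) }^{r} z_{\pi(2) }^{r} \cdots z_{\pi(j)}^{r} \right) } \, , \] where the $j=0$ factor in the denominator is $1-z_0$.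
   Context: $[m]_z=1+z+\cdots+z^{m-1}$. For $\pi\in S_n$, $\mathrm{Des}(\pi)=\{j\in[n-1]:\pi(j)>\pi(j+1)\}$. With $\omega=e^{2\pi i/r}$, $\mathbb{Z}_r\wr S_n$ is the set of pairs $(\pi,\epsilon)$, $\pi\in S_n$, $\epsilon=(\omega^{c_1},\ldots,\omega^{c_n})$, $c_j\in\{0,\ldots,r-1\}$. With $c_{n+1}:=0$, $a_j^\epsilon=(c_j-c_{j+1})\bmod r$ for $j\in[n]$, and the total color change is $\operatorname{ch}(\epsilon)=\sum_{j=1}^n a_j^\epsilon$. *)

(* Defs.v *)
From HB Require Import structures.
From mathcomp Require Import all_boot all_order all_fingroup all_algebra.
From mathcomp Require Import boolp.
From mathcomp Require Export mpoly.

Set Implicit Arguments.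
Unset Strict Implicit.
Unset Printing Implicit Defensive.

Import GRing.Theory.
Local Open Scope ring_scope.

(* R[[z_0, ..., z_(n-1)]]: a power series is its coefficient function on the  *)
(* multidegrees 'X_{1..n}; equality is extensional by funext, and the eqType  *)
(* and choiceType structures are the classical ones.                          *)

Record mpseries (n : nat) (R : Type) : Type :=
  MPSeries { mpscoef : 'X_{1..n} -> R }.

HB.instance Definition _ n (R : Type) := gen_eqMixin (mpseries n R).
HB.instance Definition _ n (R : Type) := gen_choiceMixin (mpseries n R).

Lemma mpseriesP n (R : Type) (f g : mpseries n R) :
  mpscoef f =1 mpscoef g <-> f = g.
Proof.
split=> [|-> //]; case: f g => [f] [g] /= fg.
by congr MPSeries; apply/funext.
Qed.

Lemma mdeg_addend n (m a b : 'X_{1..n}) : m == (a + b)%MM ->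
  (mdeg a <= mdeg m)%N /\ (mdeg b <= mdeg m)%N.
Proof. by move=> /eqP ->; rewrite mdegD leq_addr leq_addl. Qed.

Section Zmodule.
Variables (n : nat) (R : comNzRingType).
Implicit Types f g h : mpseries n R.

Definition mps_zero : mpseries n R := MPSeries (fun=> 0).
Definition mps_opp f : mpseries n R := MPSeries (fun m => - mpscoef f m).
Definition mps_add f g : mpseries n R :=
  MPSeries (fun m => mpscoef f m + mpscoef g m).

Fact mps_addA : associative mps_add.
Proof. by move=> f g h; apply/mpseriesP => m /=; rewrite addrA. Qed.
Fact mps_addC : commutative mps_add.
Proof. by move=> f g; apply/mpseriesP => m /=; rewrite addrC. Qed.
Fact mps_add0 : left_id mps_zero mps_add.
Proof. by move=> f; apply/mpseriesP => m /=; rewrite add0r. Qed.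
Fact mps_addN : left_inverse mps_zero mps_opp mps_add.
Proof. by move=> f; apply/mpseriesP => m /=; rewrite addNr. Qed.

HB.instance Definition _ := GRing.isZmodule.Build (mpseries n R)
  mps_addA mps_addC mps_add0 mps_addN.

Lemma mpscoef0 m : mpscoef (0 : mpseries n R) m = 0. Proof. by []. Qed.
Lemma mpscoefN f m : mpscoef (- f) m = - mpscoef f m. Proof. by []. Qed.
Lemma mpscoefD f g m : mpscoef (f + g) m = mpscoef f m + mpscoef g m.
Proof. by []. Qed.
Lemma mpscoefB f g m : mpscoef (f - g) m = mpscoef f m - mpscoef g m.
Proof. by []. Qed.

Lemma mpscoef_sum (I : Type) (s : seq I) (P : pred I) (F : I -> mpseries n R) m :
  mpscoef (\sum_(i <- s | P i) F i) m = \sum_(i <- s | P i) mpscoef (F i) m.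
Proof. by elim/big_rec2: _ => // i y1 y2 _ <-. Qed.

End Zmodule.

Section Ring.
Variables (n : nat) (R : comNzRingType).
Implicit Types f g h : mpseries n R.

Definition mps_one : mpseries n R := MPSeries (fun m => (m == 0%MM)%:R).

(* Cauchy product; the pairs (k.1, k.2) range over bounded multidegrees only  *)
(* so that the index type is finite.                                          *)
Definition mps_mul f g : mpseries n R :=
  MPSeries (fun m =>
    \sum_(k : 'X_{1..n < (mdeg m).+1, (mdeg m).+1} | m == (k.1 + k.2)%MM)
      mpscoef f k.1 * mpscoef g k.2).

Definition mps_trunc d f : {mpoly R[n]} :=
  \sum_(m : 'X_{1..n < d}) mpscoef f m *: 'X_[m].

Lemma mcoeff_trunc d f m :
  (mdeg m < d)%N -> (mps_trunc d f)@_m = mpscoef f m.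
Proof. exact: mcoeff_mpoly. Qed.

Lemma mps_mul_trunc d1 d2 f g m : (mdeg m < d1)%N -> (mdeg m < d2)%N ->
  mpscoef (mps_mul f g) m = (mps_trunc d1 f * mps_trunc d2 g)@_m.
Proof.
move=> lt1 lt2; rewrite mcoeffM /=; apply: eq_bigr => -[k1 k2] /= /mdeg_addend[le1 le2].
by rewrite !mcoeff_trunc // (leq_ltn_trans le1, leq_ltn_trans le2).
Qed.

Lemma mcoeffM_eq (p p' q q' : {mpoly R[n]}) d m : (mdeg m < d)%N ->
    (forall k, (mdeg k < d)%N -> p@_k = p'@_k) ->
    (forall k, (mdeg k < d)%N -> q@_k = q'@_k) ->
  (p * q)@_m = (p' * q')@_m.
Proof.
move=> ltm pE qE; rewrite !mcoeffM; apply: eq_bigr => -[k1 k2] /= /mdeg_addend[le1 le2].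
by rewrite pE ?qE // (leq_ltn_trans le1, leq_ltn_trans le2).
Qed.

Lemma mcoeff_trunc_mul d f g k : (mdeg k < d)%N ->
  (mps_trunc d (mps_mul f g))@_k = (mps_trunc d f * mps_trunc d g)@_k.
Proof. by move=> ltk; rewrite mcoeff_trunc // (@mps_mul_trunc d d). Qed.

Fact mps_mulA : associative mps_mul.
Proof.
move=> f g h; apply/mpseriesP => m; set d := (mdeg m).+1.
rewrite !(@mps_mul_trunc d d) //.
rewrite (@mcoeffM_eq _ (mps_trunc d f) _ (mps_trunc d g * mps_trunc d h) d) //;
  last exact: mcoeff_trunc_mul.
rewrite mulrA; apply: (@mcoeffM_eq _ _ _ _ d) => // k ltk.
by rewrite mcoeff_trunc_mul.
Qed.

Fact mps_mulC : commutative mps_mul.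
Proof.
move=> f g; apply/mpseriesP => m; set d := (mdeg m).+1.
by rewrite !(@mps_mul_trunc d d) // mulrC.
Qed.

Fact mps_mul1 : left_id mps_one mps_mul.
Proof.
move=> f; apply/mpseriesP => m; set d := (mdeg m).+1.
rewrite (@mps_mul_trunc d d) //.
rewrite (@mcoeffM_eq _ 1 _ (mps_trunc d f) d) ?mul1r ?mcoeff_trunc //.
by move=> k ltk; rewrite mcoeff_trunc // mcoeff1.
Qed.

Fact mps_mulDl : left_distributive mps_mul +%R.
Proof.
move=> f g h; apply/mpseriesP => m /=; rewrite -big_split /=.
by apply: eq_bigr => k _; rewrite mulrDl.
Qed.

Fact mps_one_neq0 : mps_one != 0.
Proof.
apply/eqP => /mpseriesP /(_ 0%MM) /= /eqP.
by rewrite eqxx oner_eq0.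
Qed.

HB.instance Definition _ := GRing.Zmodule_isComNzRing.Build (mpseries n R)
  mps_mulA mps_mulC mps_mul1 mps_mulDl mps_one_neq0.

Lemma mpscoef1 m : mpscoef (1 : mpseries n R) m = (m == 0%MM)%:R.
Proof. by []. Qed.

Lemma mpscoefM f g m : mpscoef (f * g) m =
  \sum_(k : 'X_{1..n < (mdeg m).+1, (mdeg m).+1} | m == (k.1 + k.2)%MM)
    mpscoef f k.1 * mpscoef g k.2.
Proof. by []. Qed.

Lemma mpscoefM_eq f f' g g' m :
    (forall k, (mdeg k <= mdeg m)%N -> mpscoef f k = mpscoef f' k) ->
    (forall k, (mdeg k <= mdeg m)%N -> mpscoef g k = mpscoef g' k) ->
  mpscoef (f * g) m = mpscoef (f' * g') m.
Proof.
move=> fE gE; rewrite !mpscoefM; apply: eq_bigr => -[k1 k2] /= /mdeg_addend[le1 le2].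
by rewrite fE ?gE.
Qed.

Lemma mpscoef0M f g :
  mpscoef (f * g) 0%MM = mpscoef f 0%MM * mpscoef g 0%MM.
Proof.
rewrite (@mps_mul_trunc 1 1) ?mdeg0 //.
by rewrite (rmorphM (mcoeff 0%MM)) /= !mcoeff_trunc ?mdeg0.
Qed.

Definition mpsC (c : R) : mpseries n R :=
  MPSeries (fun m => if m == 0%MM then c else 0).

Definition mpsX (i : 'I_n) : mpseries n R :=
  MPSeries (fun m => (m == U_(i)%MM)%:R).

Lemma mpscoefX_lt f j m : mpscoef f 0%MM = 0 -> (mdeg m < j)%N ->
  mpscoef (f ^+ j) m = 0.
Proof.
move=> f0; elim: j m => // j IHj m; rewrite ltnS exprS => lem.
rewrite mpscoefM big1 // => -[k1 k2] /=.
move: (bmnm k1) (bmnm k2) => a b /eqP mE.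
have [->|aN0] := eqVneq a 0%MM; first by rewrite f0 mul0r.
rewrite IHj ?mulr0 // (leq_trans _ lem) // mE mdegD -[X in (X < _)%N]add0n.
by rewrite ltn_add2r lt0n mdeg_eq0.
Qed.

(* F_0 + F_1 + ... = S in the formal topology: each coefficient of the        *)
(* partial sums is eventually constant, equal to that of S.                   *)
Definition is_mpsum (F : nat -> mpseries n R) (S : mpseries n R) : Prop :=
  forall m, exists N, forall M, (N <= M)%N ->
    mpscoef (\sum_(k < M) F k) m = mpscoef S m.

End Ring.

Section UnitRing.
Variables (n : nat) (R : comUnitRingType).
Implicit Types f g h : mpseries n R.

Definition mps_unit : pred (mpseries n R) :=
  fun f => mpscoef f 0%MM \is a GRing.unit.

(* With u the constant term of f, f^-1 is the geometric series                *)
(* u^-1 * sum_j (1 - u^-1 f)^j; only j <= |m| contributes in degree m.        *)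
Definition mps_geom d f : mpseries n R :=
  let v := mpsC n (mpscoef f 0%MM)^-1 in
  v * \sum_(j < d) (1 - v * f) ^+ j.

Definition mps_inv f : mpseries n R :=
  if mps_unit f then
    MPSeries (fun m => mpscoef (mps_geom (mdeg m).+1 f) m)
  else f.

Fact mps_mulV : {in mps_unit, left_inverse 1 mps_inv *%R}.
Proof.
move=> f fU; rewrite /mps_inv (fU : mps_unit f).
apply/mpseriesP => m; set v := mpsC n (mpscoef f 0%MM)^-1.
have g0 : mpscoef (1 - v * f) 0%MM = 0.
  by rewrite mpscoefB mpscoef1 eqxx mpscoef0M /= eqxx mulVr // subrr.
have geomE k : (mdeg k <= mdeg m)%N ->
    mpscoef (mps_geom (mdeg k).+1 f) k = mpscoef (mps_geom (mdeg m).+1 f) k.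
  move=> lek; rewrite /mps_geom -/v; apply: mpscoefM_eq => // l lel.
  have -> : (mdeg m).+1 = ((mdeg k).+1 + (mdeg m - mdeg k))%N.
    by rewrite addSn subnKC.
  rewrite [in RHS]big_split_ord /= [RHS]mpscoefD [X in _ = _ + X]mpscoef_sum.
  rewrite [X in _ = _ + X]big1 ?addr0 // => i _.
  by rewrite mpscoefX_lt // ltnS (leq_trans lel) ?leq_addr.
rewrite (@mpscoefM_eq _ _ _ (mps_geom (mdeg m).+1 f) _ f) //.
have -> : mps_geom (mdeg m).+1 f * f = 1 - (1 - v * f) ^+ (mdeg m).+1.
  rewrite /mps_geom -/v mulrAC -[RHS]opprB subrX1.
  by rewrite -[RHS]mulNr opprB opprB [_ + (v * f - 1)]addrC subrK.
by rewrite mpscoefB mpscoefX_lt // subr0.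
Qed.

Fact mps_unitPl f g : g * f = 1 -> mps_unit f.
Proof.
move=> /(congr1 (fun h => mpscoef h 0%MM)).
rewrite mpscoef0M mpscoef1 eqxx => gf1.
by apply/unitrPr; exists (mpscoef g 0%MM); rewrite mulrC.
Qed.

Fact mps_inv_out : {in [predC mps_unit], mps_inv =1 id}.
Proof. by move=> f /negbTE fU; rewrite /mps_inv [mps_unit f]fU. Qed.

HB.instance Definition _ := GRing.ComNzRing_hasMulInverse.Build (mpseries n R)
  mps_mulV mps_unitPl mps_inv_out.

Lemma mpseries_unitE f :
  (f \is a GRing.unit) = (mpscoef f 0%MM \is a GRing.unit).
Proof. by []. Qed.

End UnitRing.

Definition qint (A : pzRingType) (m : nat) (z : A) : A := \sum_(i < m) z ^+ i.

(* Positions and letters are numbered from 0: the index j in [n] is the       *)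
(* ordinal j - 1, so that j in [n-1] becomes an i : 'I_n with i.+1 < n.       *)
Definition Des n (p : 'S_n) : {set 'I_n} :=
  [set i : 'I_n | [exists i' : 'I_n, (i' == i.+1 :> nat) && (p i' < p i)%N]].

(* The pair (pi, epsilon), epsilon being given by its exponents (c_1,...,c_n) *)
(* in {0, ..., r-1}: epsilon_j = omega ^ c_j, omega a primitive r-th root.    *)
Definition wreath (r n : nat) : Type := ('S_n * {ffun 'I_n -> 'I_r})%type.
HB.instance Definition _ r n := Finite.on (wreath r n).

(* c_(j+1) for j < n, and 0 beyond (the convention c_(n+1) = 0).              *)
Definition color r n (c : {ffun 'I_n -> 'I_r}) (j : nat) : nat :=
  if insub j is Some i then c i else 0%N.

Definition color_change r n (c : {ffun 'I_n -> 'I_r}) (j : 'I_n) : nat :=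
  `|(((color c j)%:Z - (color c j.+1)%:Z) %% r%:Z)%Z|%N.

Definition total_change r n (c : {ffun 'I_n -> 'I_r}) : nat :=
  (\sum_(j < n) color_change c j)%N.

Definition ceil_div (a b : nat) : nat := `|Num.ceil (a%:Q / b%:Q)|%N.

Section Series.
Variables r n : nat.

Definition z0 : mpseries n.+1 int := mpsX int ord0.
Definition zv (j : 'I_n) : mpseries n.+1 int := mpsX int (lift ord0 j).

(* z_(pi(1))^e ... z_(pi(j))^e *)
Definition zprefix (p : 'S_n) (j e : nat) : mpseries n.+1 int :=
  \prod_(i < n | (i < j)%N) zv (p i) ^+ e.

Definition wreath_num (w : wreath r n) : mpseries n.+1 int :=
  z0 ^+ ceil_div (total_change w.2) r
  * \prod_(j < n) zprefix w.1 j.+1 (color_change w.2 j)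
  * \prod_(j in Des w.1 | color_change w.2 j == 0%N) (z0 * zprefix w.1 j.+1 r).

Definition wreath_den (w : wreath r n) : mpseries n.+1 int :=
  \prod_(j < n.+1) (1 - z0 * zprefix w.1 j r).

Lemma wreath_den_unit (w : wreath r n) : wreath_den w \is a GRing.unit.
Proof.
apply/unitr_prod_in => j _; rewrite mpseries_unitE mpscoefB mpscoef1 mpscoef0M.
suff -> : mpscoef z0 0%MM = 0 by rewrite mul0r subr0 eqxx unitr1.
by rewrite /= eq_sym -mdeg_eq0 mdeg1.
Qed.

End Series.

(* Main.v *)
(* The coefficient of z_0^k z^v on the left is 1 if max v <= r k and 0        *)
(* otherwise. On the right, expanding the geometric series, it counts the     *)
(* triples (pi, epsilon, b) with b_0, ..., b_n >= 0 whose monomial is         *)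
(* z_0^k z^v, i.e. such that                                                  *)
(*   v_(pi(j)) - v_(pi(j+1)) = a_j + r ([j in Des pi, a_j = 0] + b_j),        *)
(* with v_(pi(n+1)) = 0, and z_0 has total exponent k. Modulo r this forces   *)
(* c_j = v_(pi(j)) mod r. A tie v_(pi(j)) = v_(pi(j+1)) excludes a descent    *)
(* at j, so pi sorts v decreasingly, breaking ties increasingly, and is       *)
(* unique; then b_1, ..., b_n are determined. Summing the differences, the    *)
(* exponent of z_0 is b_0 + ceil (max v / r), so b_0 exists, uniquely, if and *)
(* only if max v <= r k.                                                      *)

Require Import Defs.
From mathcomp Require Import all_boot all_order all_fingroup all_algebra.
From mathcomp Require Import zify.

Set Implicit Arguments.
Unset Strict Implicit.
Unset Printing Implicit Defensive.

Import Order.TTheory GRing.Theory Num.Theory.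
Local Open Scope nat_scope.

(** Fix a monomial z_0^k z^v and compare coefficients. On the left only the k-th summand matters; it
    contributes 1 exactly when v lies in the cube [0, rk]^n ([mpscoef_box_sum]). On the right,
    expanding the denominators turns the coefficient into a count of pairs of a colored permutation
    [w] and exponents [b] ([mpscoef_wreath_sum]), and [term_monP] rewrites the condition on a pair
    as [encodes].

    Each lattice point of the cube has one encoding: sort the entries of v decreasingly, ties by
    index; the residues mod r of the sorted entries are the colors; the quotients by r of
    consecutive differences, less 1 at a descent with a_j = 0, are b_1, ..., b_n; and b_0 is the
    slack k - ceil (max v / r). Thus [encodes_le] excludes points outside the cube, [ex_encodes] and
    [encodes_inj] give exactly one encoding inside, and [card_term_mon] concludes. *)

(** * Ceilings and color changes *)

Lemma leq_ceil_div r a k : 0 < r -> (ceil_div a r <= k) = (a <= r * k).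
Proof.
move=> r0; rewrite /ceil_div.
have c0 : (0 <= Num.ceil (a%:Q / r%:Q))%R.
  by rewrite ceil_ge0 (lt_le_trans (ltrN10 _)) // divr_ge0 // ler0n.
rewrite -lez_nat gez0_abs // ceil_le_int ler_pdivrMr ?ltr0n //.
by rewrite -natrM ler_nat mulnC.
Qed.

Lemma ceil_divDM r a t : 0 < r -> ceil_div (a + r * t) r = ceil_div a r + t.
Proof.
move=> r0; apply/eqP; rewrite eqn_leq leq_ceil_div // mulnDr leq_add2r.
rewrite -leq_ceil_div // leqnn /=.
have : a + r * t <= r * ceil_div (a + r * t) r by rewrite -leq_ceil_div.
move=> le; have tle : t <= ceil_div (a + r * t) r.
  by rewrite -(leq_pmul2l r0) (leq_trans (leq_addl _ _) le).
by rewrite addnC -leq_subRL // leq_ceil_div // mulnBr leq_subRL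
  ?leq_mul2l ?tle ?orbT // addnC.
Qed.

Lemma color_change_lt r n (c : {ffun 'I_n -> 'I_r}) j :
  0 < r -> color_change c j < r.
Proof. by move=> r0; rewrite /color_change; lia. Qed.

Lemma color_change_modn r n (c : {ffun 'I_n -> 'I_r}) (j : 'I_n) :
  0 < r -> color c j.+1 + color_change c j = color c j %[mod r].
Proof.
rewrite /color_change; move: (color c j) (color c j.+1) => x y r0.
apply/eqP; rewrite -eqz_nat -!modz_nat PoszD gez0_abs; last first.
  by rewrite modz_ge0 // -lt0n.
by rewrite modzDmr addrC subrK.
Qed.


(** * The unique sorting permutation of a vector *)

Section Sorting.
Variables (n : nat) (v : 'I_n -> nat).

(** Breaking ties by index makes this a total order, so exactly one permutation sorts v. *)
Definition precedes : rel 'I_n :=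
  fun x y => (v y < v x) || (v x == v y) && (x <= y).

Lemma precedes_trans : transitive precedes.
Proof. by move=> y x z; rewrite /precedes; lia. Qed.

Lemma precedes_anti : antisymmetric precedes.
Proof. by move=> x y; rewrite /precedes => H; apply/val_inj => /=; lia. Qed.

Lemma precedes_total : total precedes.
Proof. by move=> x y; rewrite /precedes; lia. Qed.

Definition sorts (p : 'S_n) := sorted precedes (codom p).

Lemma nth_codom_ord (p : 'S_n) x0 (i : 'I_n) : nth x0 (codom p) i = p i.
Proof. by rewrite codomE (nth_map i) ?size_enum_ord // nth_ord_enum. Qed.

Lemma sortsP (p : 'S_n) :
  reflect (forall j j' : 'I_n, j' = j.+1 :> nat -> precedes (p j) (p j'))
          (sorts p).
Proof.
have szE : size (codom p) = n by rewrite size_codom card_ord.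
apply: (iffP idP) => [|H].
  move=> sp j j' jE.
  rewrite -(nth_codom_ord p (p j) j) -(nth_codom_ord p (p j) j') jE.
  by move/(sortedP (p j)): sp; apply; rewrite szE -jE.
rewrite /sorts; case: {2}n (erefl n) => [n0|n' nE].
  by rewrite (size0nil (s := codom p)) // szE.
have x0 : 'I_n by rewrite nE; exact: ord0.
apply/(sortedP x0) => i; rewrite szE => lti.
by rewrite (nth_codom_ord p x0 (Ordinal (ltnW lti)))
  (nth_codom_ord p x0 (Ordinal lti)) H.
Qed.

Lemma sorts_inj (p q : 'S_n) : sorts p -> sorts q -> p = q.
Proof.
move=> sp sq; have pq : codom p = codom q.
  apply: (sorted_eq precedes_trans precedes_anti sp sq).
  apply: uniq_perm; try by rewrite map_inj_uniq ?enum_uniq //; apply: perm_inj.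
  by move=> x; rewrite -(permKV p x) codom_f permKV -(permKV q x) codom_f.
apply/permP => i.
by rewrite -(nth_codom_ord p (p i)) pq nth_codom_ord.
Qed.

Lemma ex_sorts : exists p : 'S_n, sorts p.
Proof.
have /tuple_permP[p pE] : perm_eq (sort precedes (enum 'I_n)) (ord_tuple n).
  by rewrite perm_sort val_ord_tuple.
exists p; rewrite /sorts (_ : codom p = sort precedes (enum 'I_n)).
  exact: sort_sorted precedes_total _.
by rewrite pE codomE /=; apply: eq_map => i; rewrite tnth_ord_tuple.
Qed.

End Sorting.

(** * Lattice points encoded by colored permutations *)

Section Encoding.
Variables r n : nat.
Implicit Types (p : 'S_n) (c : {ffun 'I_n -> 'I_r}) (v : 'I_n -> nat).
Implicit Types w : wreath r n.

(** The positions of the extra numerator factors: descents where the color change alone would allow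
    a tie. *)
Definition flat_des w (j : 'I_n) :=
  (j \in Des w.1) && (color_change w.2 j == 0).

(** The default 0 is the convention v_(pi(n+1)) = 0, parallel to c_(n+1) = 0. *)
Definition at_pos v p (j : nat) : nat :=
  if insub j is Some i then v (p i) else 0.

Lemma at_pos_ord v p (i : 'I_n) : at_pos v p i = v (p i).
Proof. by rewrite /at_pos insubT // => lt; congr (v (p _)); apply: val_inj. Qed.

Lemma at_pos_out v p j : n <= j -> at_pos v p j = 0.
Proof. by move=> le; rewrite /at_pos insubN // -leqNgt. Qed.

Lemma color_out c j : n <= j -> color c j = 0.
Proof. by move=> le; rewrite /color insubN // -leqNgt. Qed.

Lemma color_ord c (i : 'I_n) : color c i = c i.
Proof.
by rewrite /color insubT //= => lt; congr (val (c _)); apply: val_inj.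
Qed.

Lemma ord_down_ind (P : nat -> Prop) :
  (forall j, n <= j -> P j) -> (forall j : 'I_n, P j.+1 -> P j) ->
  forall j, P j.
Proof.
move=> Pout PS j; move: {2}(n - j) (erefl (n - j)) => d.
elim: d j => [|d IHd] j dE; first by apply: Pout; lia.
have lt : j < n by lia.
by apply: (PS (Ordinal lt)); apply: IHd => /=; lia.
Qed.

(** The shift [lift ord0 j] matches position j, counted from 0, with the denominator factor of
    prefix length j + 1. *)
Definition jump w (b : 'I_n.+1 -> nat) (j : 'I_n) : nat :=
  color_change w.2 j + r * (flat_des w j + b (lift ord0 j)).

(** The exponent of z_0 in an expanded term; see [term_mon_ord0]. *)
Definition height w (b : 'I_n.+1 -> nat) : nat :=
  ceil_div (total_change w.2) r + \sum_(j < n) flat_des w j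
  + \sum_(j < n.+1) b j.

Definition encodes v k w (b : 'I_n.+1 -> nat) : Prop :=
  (forall j : 'I_n, at_pos v w.1 j = at_pos v w.1 j.+1 + jump w b j)
  /\ k = height w b.

(** Telescoping from the last position. Tail sums are the form in which exponents arise from
    products of prefix monomials. *)
Lemma at_pos_tailE v p (d : 'I_n -> nat) :
  (forall j : 'I_n, at_pos v p j = at_pos v p j.+1 + d j) <->
  (forall i : 'I_n, v (p i) = \sum_(j < n | i <= j) d j).
Proof.
have tailS (i : 'I_n) :
    \sum_(j < n | i <= j) d j = \sum_(j < n | i < j) d j + d i.
  rewrite (bigD1 i) //= addnC; congr (_ + _); apply: eq_bigl => j.
  by rewrite -val_eqE /=; lia.
have tail_out i : n <= i -> \sum_(j < n | i <= j) d j = 0.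
  by move=> le; rewrite big_pred0 // => j; have := ltn_ord j; lia.
split=> H i; last first.
  rewrite at_pos_ord H tailS; congr (_ + _).
  have [le|lt] := leqP n i.+1; first by rewrite at_pos_out // tail_out.
  by rewrite (at_pos_ord v p (Ordinal lt)) H.
rewrite -at_pos_ord; move: (i : nat); apply: ord_down_ind => [j le|j IHj].
  by rewrite at_pos_out // tail_out.
by rewrite H IHj -tailS.
Qed.

Lemma sum_jump w b :
  \sum_(j < n) jump w b j =
  total_change w.2
  + r * (\sum_(j < n) flat_des w j + \sum_(j < n) b (lift ord0 j)).
Proof. by rewrite /jump big_split /= -big_distrr big_split. Qed.

Variable r_gt0 : 0 < r.

Lemma color_lt c j : color c j < r.
Proof. by rewrite /color; case: insub => //= i. Qed.

(** Multiples of r leave the ceiling. For an encoding of v, the sum of the jumps telescopes to the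
    largest entry of v. *)
Lemma heightE w b :
  height w b = b ord0 + ceil_div (\sum_(j < n) jump w b j) r.
Proof. by rewrite sum_jump ceil_divDM // /height big_ord_recl; lia. Qed.

Lemma encodes_le v k w b : encodes v k w b -> forall x, v x <= r * k.
Proof.
case=> /at_pos_tailE vE -> x; rewrite -(permKV w.1 x) vE -leq_ceil_div //.
rewrite heightE (leq_trans _ (leq_addl _ _)) // leq_ceil_div //.
rewrite (leq_trans (n := \sum_(j < n) jump w b j)) //; last first.
  by rewrite -leq_ceil_div.
by rewrite [X in _ <= X](bigID (fun j : 'I_n => w.1^-1%g x <= j)) /= leq_addr.
Qed.

(** Modulo r a jump is just the color change, so colors and entries satisfy the same recursion down
    from 0. *)
Lemma encodes_color v k w b : encodes v k w b ->
  forall j, color w.2 j = at_pos v w.1 j %% r.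
Proof.
case=> vE _; apply: ord_down_ind => [j le|j IHj].
  by rewrite color_out // at_pos_out // mod0n.
rewrite -[LHS](modn_small (color_lt _ _)) -color_change_modn // IHj modnDml vE.
by rewrite /jump addnA -[RHS]modnDmr modnMr addn0.
Qed.

Lemma DesP p (j j' : 'I_n) : j' = j.+1 :> nat -> (j \in Des p) = (p j' < p j).
Proof.
move=> jE; rewrite inE; apply/existsP/idP => [[i /andP[/eqP iE]]|lt].
  by rewrite (_ : i = j') //; apply: val_inj; rewrite /= iE.
by exists j'; rewrite jE eqxx.
Qed.

(** Jumps are nonnegative, and at a descent the jump is positive: either a_j > 0 or the extra factor
    adds r. So ties occur only at ascents. *)
Lemma encodes_sorts v k w b : encodes v k w b -> sorts v w.1.
Proof.
case=> vE _; apply/sortsP => j j' jE; have := vE j.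
rewrite -jE !at_pos_ord /jump /precedes /flat_des (DesP _ jE).
have [a0|] := eqVneq (color_change w.2 j) 0; last by lia.
have [lt|le] := ltnP (w.1 j') (w.1 j); last by lia.
by rewrite a0 /=; nia.
Qed.

Lemma encodes_inj v k w w' b b' :
  encodes v k w b -> encodes v k w' b' -> w = w' /\ b =1 b'.
Proof.
move=> e e'; have pE := sorts_inj (encodes_sorts e) (encodes_sorts e').
have wE : w = w'.
  case: w w' pE e e' => [p c] [p' c'] /= <- e e'; congr (_, _).
  apply/ffunP => i; apply: val_inj; rewrite /= -!color_ord.
  by rewrite (encodes_color e) (encodes_color e').
split=> //; rewrite -{}wE in e' => {pE w'}.
have bS j : b (lift ord0 j) = b' (lift ord0 j).
  have := e'.1 j; rewrite e.1 /jump => /addnI/addnI/eqP.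
  by rewrite eqn_pmul2l // => /eqP/addnI.
move=> i; case: (unliftP ord0 i) => [j ->|->] //.
have := e'.2; rewrite e.2 !heightE.
rewrite (eq_bigr (jump w b')); last by move=> j _; rewrite /jump bS.
by move/addIn.
Qed.

Lemma ex_encodes v k : (forall x, v x <= r * k) -> exists w b, encodes v k w b.
Proof.
move=> vk; have [p /sortsP sp] := ex_sorts v.
pose c : {ffun 'I_n -> 'I_r} := [ffun i => Ordinal (ltn_pmod (v (p i)) r_gt0)].
have cE j : color c j = at_pos v p j %% r.
  by rewrite /color /at_pos; case: insub => [i|]; rewrite ?ffunE ?mod0n.
pose w : wreath r n := (p, c).
have key (j : 'I_n) : exists t,
    at_pos v p j =
    at_pos v p j.+1 + (color_change c j + r * (flat_des w j + t)).
  have a_lt := color_change_lt c j r_gt0.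
  have := color_change_modn c j r_gt0; rewrite !cE modn_mod modnDml.
  set a := color_change c j in a_lt *.
  set x := at_pos v p j; set y := at_pos v p j.+1.
  move=> aE.
  (* At the last position y = 0 and there is no descent; elsewhere this is sortedness. *)
  have [yx fl] : y <= x /\ (flat_des w j -> y < x).
    rewrite /x /y /flat_des; have [le|lt] := leqP n j.+1.
      rewrite (at_pos_out _ _ le); split=> // /andP[].
      rewrite inE => /existsP[i /andP[/eqP iE _]].
      by have := ltn_ord i; rewrite iE; lia.
    have := sp j (Ordinal lt) erefl.
    rewrite /precedes (DesP _ (j' := Ordinal lt)) //.
    rewrite at_pos_ord (at_pos_ord v p (Ordinal lt)) /=.
    move: (p j) (p (Ordinal lt)) => s t; lia.
  have dE : x - y = a %[mod r].
    by apply/eqP; rewrite -(eqn_modDl y) subnKC // aE.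
  rewrite (modn_small a_lt) in dE.
  (* At a flat descent x - y is a positive multiple of r, so the quotient is at least 1 and the
     subtraction does not truncate. *)
  exists ((x - y) %/ r - flat_des w j).
  have fq : flat_des w j <= (x - y) %/ r.
    case fd: (flat_des w j) => //.
    rewrite divn_gt0 // dvdn_leq ?subn_gt0 ?fl //.
    by rewrite /dvdn dE; case/andP: fd.
  by rewrite subnKC // addnC [r * _]mulnC [a + _]addnC -dE -divn_eq subnK.
have [t tE] := fin_all_exists key.
(* [jump] ignores the entry at index 0, so the jumps are fixed first and that entry is then set to
   the slack [k - s]. *)
pose b0 i := if unlift ord0 i is Some j then t j else 0.
have b0S j : b0 (lift ord0 j) = t j by rewrite /b0 liftK.
pose s := ceil_div (\sum_(j < n) jump w b0 j) r.
pose b i := if unlift ord0 i is Some j then t j else k - s.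
have jE : jump w b =1 jump w b0 by move=> j; rewrite /jump /b /b0 liftK.
have vE (j : 'I_n) : at_pos v p j = at_pos v p j.+1 + jump w b0 j.
  by rewrite {1}tE /jump b0S.
exists w, b; split=> [j|]; first by rewrite jE.
rewrite heightE (eq_bigr _ (fun j _ => jE j)) -/s /b unlift_none subnK //.
rewrite /s leq_ceil_div //; case: (posnP n) => [n0|n0].
  by rewrite big1 // => i; have := ltn_ord i; rewrite {2}n0.
(* The jumps sum to the entry of v at the first position, which is at most rk. *)
have := vk (p (Ordinal n0)); move/at_pos_tailE: vE => ->.
by rewrite (eq_bigl predT).
Qed.

End Encoding.

Local Open Scope ring_scope.

(** * Monomials and truncated geometric series *)

Section Monomials.
Variables (n : nat) (R : comNzRingType).
Implicit Types (f g : mpseries n R) (a b m : 'X_{1..n}).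

Definition mpsM m : mpseries n R := MPSeries (fun m' => (m' == m)%:R).

Lemma mpsM0 : mpsM 0%MM = 1. Proof. by []. Qed.

Lemma mpsMD a b : mpsM (a + b)%MM = mpsM a * mpsM b.
Proof.
apply/mpseriesP => m; rewrite mpscoefM /=.
have [->|neq] := eqVneq m (a + b)%MM; last first.
  rewrite big1 // => -[k1 k2] /= /eqP mE.
  case: eqP => [k1E|_]; last by rewrite mul0r.
  case: eqP => [k2E|_]; last by rewrite mulr0.
  by rewrite mE k1E k2E eqxx in neq.
have lta : (mdeg a < (mdeg (a + b)%MM).+1)%N by rewrite ltnS mdegD leq_addr.
have ltb : (mdeg b < (mdeg (a + b)%MM).+1)%N by rewrite ltnS mdegD leq_addl.
rewrite (bigD1 (BMultinom lta, BMultinom ltb)) //= !eqxx mulr1.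
rewrite big1 ?addr0 // => -[k1 k2] /= /andP[_ neq].
case: eqP => [k1E|_]; last by rewrite mul0r.
case: eqP => [k2E|_]; last by rewrite mulr0.
by case/negP: neq; rewrite xpair_eqE -!val_eqE /= k1E k2E !eqxx.
Qed.

Lemma mpsMX m e : mpsM m ^+ e = mpsM (m *+ e)%MM.
Proof.
by elim: e => [|e IHe]; rewrite ?mulm0n ?expr0 // exprS IHe -mpsMD mulmS.
Qed.

Lemma mpsM_prod (I : Type) (s : seq I) (P : pred I) (F : I -> 'X_{1..n}) :
  \prod_(i <- s | P i) mpsM (F i) = mpsM (\sum_(i <- s | P i) F i)%MM.
Proof. by elim/big_rec2: _ => [|i y1 y2 _ ->]; rewrite ?mpsM0 ?mpsMD. Qed.

Definition mps_eqmod d f g :=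
  forall k, (mdeg k <= d)%N -> mpscoef f k = mpscoef g k.

Lemma mps_eqmodM d f f' g g' :
  mps_eqmod d f f' -> mps_eqmod d g g' -> mps_eqmod d (f * g) (f' * g').
Proof.
move=> ff gg k lek; apply: mpscoefM_eq => l lel; [apply: ff|apply: gg];
exact: leq_trans lel lek.
Qed.

Lemma mps_eqmod_prod d (I : Type) (s : seq I) (P : pred I)
    (F G : I -> mpseries n R) :
  (forall i, P i -> mps_eqmod d (F i) (G i)) ->
  mps_eqmod d (\prod_(i <- s | P i) F i) (\prod_(i <- s | P i) G i).
Proof.
by move=> FG; elim/big_rec2: _ => // i y1 y2 Pi; apply: mps_eqmodM; apply: FG.
Qed.

End Monomials.

Arguments mpsM {n} R m.

Lemma mps_inv_geom n (R : comUnitRingType) d (f : mpseries n R) :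
  mpscoef f 0%MM = 0 ->
  mps_eqmod d (1 - f)^-1 (\sum_(j < d.+1) f ^+ j).
Proof.
move=> f0 k lek.
have U : 1 - f \is a GRing.unit.
  by rewrite mpseries_unitE mpscoefB mpscoef1 eqxx f0 subr0 unitr1.
(* The remainder has no term of degree at most d, since f has zero constant term. *)
have E : (1 - f)^-1 = \sum_(j < d.+1) f ^+ j + f ^+ d.+1 * (1 - f)^-1.
  apply: (mulrI U); rewrite mulrV // mulrDr mulrCA mulrV // mulr1.
  by rewrite -[1 - f]opprB mulNr -subrX1 opprB subrK.
rewrite E mpscoefD [X in _ + X]mpscoefM [X in _ + X]big1 ?addr0 //.
move=> -[k1 k2] /= /mdeg_addend[le1 _].
by rewrite mpscoefX_lt ?mul0r // ltnS (leq_trans le1).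
Qed.

Lemma mpscoef_sumM n (R : comNzRingType) (I : finType) (F : I -> 'X_{1..n}) m :
  mpscoef (\sum_i mpsM R (F i)) m = #|[pred i | m == F i]|%:R.
Proof.
rewrite mpscoef_sum /= -natr_sum -sum1_card [in RHS]big_mkcond.
by congr (_%:R); apply: eq_bigr => i _; rewrite inE; case: eqP.
Qed.

(** * Coefficients of both sides *)

Section Expo.
Variables r n : nat.
Implicit Types w : wreath r n.

Definition prefix_mon (p : 'S_n) (j e : nat) : 'X_{1..n.+1} :=
  (\sum_(i < n | (i < j)%N) U_(lift ord0 (p i)) *+ e)%MM.

Definition step_mon (p : 'S_n) (j : nat) : 'X_{1..n.+1} :=
  (U_(ord0) + prefix_mon p j r)%MM.

Definition num_mon w : 'X_{1..n.+1} :=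
  (U_(ord0) *+ ceil_div (total_change w.2) r
   + \sum_(j < n) prefix_mon w.1 j.+1 (color_change w.2 j)
   + \sum_(j < n | flat_des w j) step_mon w.1 j.+1)%MM.

Definition term_mon w (b : 'I_n.+1 -> nat) : 'X_{1..n.+1} :=
  (num_mon w + \sum_(j < n.+1) step_mon w.1 j *+ b j)%MM.

Lemma zprefixE p j e : zprefix p j e = mpsM int (prefix_mon p j e).
Proof.
rewrite /zprefix -mpsM_prod; apply: eq_bigr => i _; exact: mpsMX.
Qed.

Lemma z0_zprefixE p j : z0 n * zprefix p j r = mpsM int (step_mon p j).
Proof. by rewrite zprefixE mpsMD. Qed.

Lemma wreath_numE w : wreath_num w = mpsM int (num_mon w).
Proof.
rewrite /wreath_num !mpsMD -mpsMX; congr (_ * _ * _).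
  by rewrite -mpsM_prod; apply: eq_bigr => j _; rewrite zprefixE.
by rewrite -mpsM_prod; apply: eq_bigr => j _; rewrite z0_zprefixE.
Qed.

(** Every step monomial has positive degree, so exponents up to d suffice in degree at most d; this
    keeps the index type finite. *)
Lemma wreath_den_inv d w :
  mps_eqmod d (wreath_den w)^-1
    (\sum_(b : {ffun 'I_n.+1 -> 'I_d.+1})
       mpsM int (\sum_(j < n.+1) step_mon w.1 j *+ b j)%MM).
Proof.
have c0 j : mpscoef (z0 n * zprefix w.1 j r) 0%MM = 0.
  by rewrite mpscoef0M /= eq_sym -mdeg_eq0 mdeg1 mul0r.
rewrite /wreath_den -prodrV; last first.
  move=> j _; rewrite mpseries_unitE mpscoefB mpscoef1 eqxx.
  by rewrite (c0 j) subr0 unitr1.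
have -> : \sum_(b : {ffun 'I_n.+1 -> 'I_d.+1})
    mpsM int (\sum_(j < n.+1) step_mon w.1 j *+ b j)%MM
  = \prod_(j < n.+1) \sum_(e < d.+1) (z0 n * zprefix w.1 j r) ^+ e.
  rewrite bigA_distr_bigA; apply: eq_bigr => b _; rewrite -mpsM_prod.
  by apply: eq_bigr => j _; rewrite z0_zprefixE mpsMX.
by apply: mps_eqmod_prod => j _; apply: mps_inv_geom.
Qed.

Lemma mpscoef_wreath_sum m :
  mpscoef (\sum_(w : wreath r n) wreath_num w / wreath_den w) m =
  #|[pred wb : wreath r n * {ffun 'I_n.+1 -> 'I_(mdeg m).+1}
      | m == term_mon wb.1 (fun j => wb.2 j)]|%:R.
Proof.
rewrite -mpscoef_sumM !mpscoef_sum -(pair_bigA _ 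
  (fun w (b : {ffun 'I_n.+1 -> 'I_(mdeg m).+1}) =>
    mpscoef (mpsM int (term_mon w (fun j => b j))) m)) /=.
apply: eq_bigr => w _.
transitivity (mpscoef (wreath_num w *
  \sum_(b : {ffun 'I_n.+1 -> 'I_(mdeg m).+1})
    mpsM int (\sum_(j < n.+1) step_mon w.1 j *+ b j)%MM) m).
  exact: (mps_eqmodM (fun k _ => erefl (mpscoef (wreath_num w) k))
           (@wreath_den_inv (mdeg m) w) (leqnn _)).
rewrite mulr_sumr mpscoef_sum; apply: eq_bigr => b _.
by rewrite wreath_numE -mpsMD.
Qed.

Lemma mpscoef_box_sum M (m : 'X_{1..n.+1}) : (m ord0 < M)%N ->
  mpscoef (\sum_(k < M)
    ((\prod_(j < n) qint (r * k + 1)%N (zv j)) * z0 n ^+ k)) m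
  = [forall j : 'I_n, m (lift ord0 j) <= r * m ord0]%N%:R.
Proof.
move=> ltM; rewrite mpscoef_sum.
have E (k : nat) :
    mpscoef ((\prod_(j < n) qint (r * k + 1)%N (zv j)) * z0 n ^+ k) m
   = #|[pred b : {ffun 'I_n -> 'I_(r * k + 1)} |
         m == (\sum_(j < n) U_(lift ord0 j) *+ b j + U_(ord0) *+ k)%MM]|%:R.
  rewrite -mpscoef_sumM /qint bigA_distr_bigA mulr_suml; congr mpscoef.
  apply: eq_bigr => b _; rewrite mpsMD -mpsMX -mpsM_prod; congr (_ * _).
  by apply: eq_bigr => j _; rewrite mpsMX.
have charE (k : nat) (b : 'I_n -> nat) :
    (m == (\sum_(j < n) U_(lift ord0 j) *+ b j + U_(ord0) *+ k)%MM)
    = (m ord0 == k) && [forall j : 'I_n, m (lift ord0 j) == b j].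
  have e0 : (\sum_(j < n) U_(lift ord0 j) *+ b j + U_(ord0) *+ k)%MM ord0 = k.
    rewrite mnmDE mnm_sumE big1 => [|j _]; rewrite mulmnE mnm1E.
      by rewrite eqxx mul1n.
    by rewrite eq_sym (negbTE (neq_lift _ _)).
  have eS i :
      (\sum_(j < n) U_(lift ord0 j) *+ b j + U_(ord0) *+ k)%MM (lift ord0 i) = b i.
    rewrite mnmDE mnm_sumE (bigD1 i) //= big1 => [|j neq];
      rewrite !mulmnE !mnm1E.
      by rewrite eqxx mul1n (negbTE (neq_lift _ _)) addn0 addn0.
    by rewrite (inj_eq lift_inj) (negbTE neq).
  apply/eqP/andP => [->|[/eqP k0 /forallP bE]].
    by rewrite e0; split=> //; apply/forallP => j; rewrite eS.
  apply/mnmP => i; case: (unliftP ord0 i) => [j ->|->]; last by rewrite e0.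
  by rewrite eS; apply/eqP.
rewrite (eq_bigr _ (fun (k : 'I_M) _ => E k)).
rewrite (bigD1 (Ordinal ltM)) //= big1 ?addr0 => [|k neq].
  congr (_%:R).
  case: forallP => [le|nle]; last first.
    apply: eq_card0 => b; rewrite !inE charE eqxx /=; apply/negP => /forallP bE.
    by apply: nle => j; rewrite (eqP (bE j)) -ltnS
      (leq_trans (ltn_ord _)) ?addn1.
  have lt j : (m (lift ord0 j) < r * m ord0 + 1)%N by rewrite addn1 ltnS.
  rewrite (eq_card (B := pred1 [ffun j => Ordinal (lt j)])) ?card1 // => b.
  rewrite !inE charE eqxx /=.
  apply/forallP/eqP => [bE|-> j]; last by rewrite ffunE.
  by apply/ffunP => j; rewrite ffunE; apply/val_inj; rewrite /= (eqP (bE j)).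
rewrite eq_card0 // => b; rewrite !inE charE; apply/andP => -[/eqP k0 _].
by case/eqP: neq; apply/val_inj.
Qed.


Lemma prefix_mon_ord0 p j e : prefix_mon p j e ord0 = 0%N.
Proof.
rewrite mnm_sumE big1 // => i _.
by rewrite mulmnE mnm1E eq_sym (negbTE (neq_lift _ _)).
Qed.

Lemma prefix_mon_lift (p : 'S_n) j e (i : 'I_n) :
  prefix_mon p j e (lift ord0 (p i)) = ((i < j) * e)%N.
Proof.
rewrite mnm_sumE (big_mkcond (fun i : 'I_n => i < j)%N) (bigD1 i) //=.
rewrite big1 => [|i' neq]; last first.
  rewrite mulmnE mnm1E (inj_eq lift_inj) (inj_eq perm_inj) (negbTE neq).
  by case: ifP.
by rewrite mulmnE mnm1E eqxx addn0; case: ifP; rewrite ?mul1n ?mul0n.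
Qed.

Lemma step_mon_ord0 p j : step_mon p j ord0 = 1%N.
Proof. by rewrite mnmDE prefix_mon_ord0 mnm1E eqxx. Qed.

Lemma step_mon_lift (p : 'S_n) j (i : 'I_n) :
  step_mon p j (lift ord0 (p i)) = ((i < j) * r)%N.
Proof. by rewrite mnmDE prefix_mon_lift mnm1E (negbTE (neq_lift _ _)). Qed.

Lemma term_mon_ord0 w b : term_mon w b ord0 = height w b.
Proof.
rewrite !mnmDE !mnm_sumE mulmnE mnm1E eqxx mul1n /height.
rewrite (eq_bigr (fun=> 0%N)) => [|j _]; last by rewrite prefix_mon_ord0.
rewrite sum_nat_const muln0 addn0 big_mkcond.
congr (_ + _ + _)%N; apply: eq_bigr => j _.
  by case: (flat_des w j) => //; rewrite step_mon_ord0.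
by rewrite mulmnE step_mon_ord0 mul1n.
Qed.

(** The letter at position i occurs in the prefix ending at j exactly when i <= j, hence a tail
    sum. *)
Lemma term_mon_lift w b (i : 'I_n) :
  term_mon w b (lift ord0 (w.1 i)) = (\sum_(j < n | i <= j) jump w b j)%N.
Proof.
rewrite !mnmDE !mnm_sumE mulmnE mnm1E (negbTE (neq_lift _ _)) mul0n add0n.
rewrite big_ord_recl mulmnE step_mon_lift ltn0 !mul0n add0n.
rewrite (big_mkcond (flat_des w)) -!big_split [RHS]big_mkcond.
apply: eq_bigr => j _; rewrite /= prefix_mon_lift mulmnE !step_mon_lift ltnS.
by rewrite /jump; case: leqP => _; case: (flat_des w j) => /=; lia.
Qed.

Lemma term_monP (m : 'X_{1..n.+1}) w b :
  m = term_mon w b <-> encodes (fun x => m (lift ord0 x)) (m ord0) w b.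
Proof.
split=> [->|[/at_pos_tailE vE kE]].
  by split; [apply/at_pos_tailE => i; rewrite term_mon_lift
            |rewrite term_mon_ord0].
apply/mnmP => i; case: (unliftP ord0 i) => [x ->|->]; last first.
  by rewrite term_mon_ord0.
by rewrite -(permKV w.1 x) vE term_mon_lift.
Qed.

Lemma card_term_mon (m : 'X_{1..n.+1}) : (0 < r)%N ->
  #|[pred wb : wreath r n * {ffun 'I_n.+1 -> 'I_(mdeg m).+1}
      | m == term_mon wb.1 (fun j => wb.2 j)]|
  = [forall j : 'I_n, m (lift ord0 j) <= r * m ord0]%N.
Proof.
move=> r_gt0; case: forallP => [le|nle]; last first.
  apply: eq_card0 => -[w b]; rewrite !inE; apply/negP => /eqP/term_monP e.
  by apply: nle => j; apply: (encodes_le r_gt0 e).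
have [w [b e]] := ex_encodes r_gt0 le.
(* Each b_j is at most the height, which is the z_0-exponent of m, so the bounded exponents miss no
   encoding. *)
have lt j : (b j < (mdeg m).+1)%N.
  rewrite ltnS (leq_trans (n := m ord0)) //; last first.
    by rewrite mdegE (bigD1 ord0) //= leq_addr.
  by rewrite e.2 /height [X in (_ <= _ + X)%N](bigD1 j) //=; lia.
rewrite (eq_card (B := pred1 (w, [ffun j => Ordinal (lt j)]))) ?card1 //.
move=> [w' b']; rewrite !inE; apply/eqP/eqP => [/term_monP e'|[-> ->]].
  have [/= -> bE] := encodes_inj r_gt0 e' e.
  by congr (_, _); apply/ffunP => j; rewrite ffunE; apply: val_inj; apply: bE.
apply/term_monP; case: e => vE kE; split=> [j|].
  by rewrite /= vE /jump ffunE.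
by rewrite kE /height; congr addn; apply: eq_bigr => j _; rewrite ffunE.
Qed.

End Expo.

Theorem theorem5p23 (r n : nat) (r_gt0 : (0 < r)%N) (n_gt0 : (0 < n)%N) :
  is_mpsum
    (fun k : nat => (\prod_(j < n) qint (r * k + 1)%N (zv j)) * z0 n ^+ k)
    (\sum_(w : wreath r n) wreath_num w / wreath_den w).
Proof.
move=> m; exists (m ord0).+1 => M ltM.
by rewrite mpscoef_box_sum // mpscoef_wreath_sum card_term_mon.
Qed.
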